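(* Let $(X,d)$ be a complete metric space and let $f,g: X\to X$ be two commuting maps (i.e. $f\circ g=g\circ f$), with $f$ continuous. Assume that there is a real constant $0<k<1$ such that $d(g(x),g(y))\le k\, d(f(x),f(y))$ for all $x,y\in X$. If there exists an element $x_0\in X$ such that the sequence $\{f^n(x_0)\}_{n\ge 0}$ is bounded, then $f$ and $g$ possess a unique common fixed point in $X$, i.e. there is exactly one $p\in X$ with $f(p)=g(p)=p$.
   Context: Iterates: $f^0(x)=x$ and $f^{n+1}(x)=f(f^n(x))$. *)

(* Defs.v *)
From mathcomp Require Import all_boot all_order all_algebra.
From mathcomp Require Import all_classical all_reals all_analysis.

Set Implicit Arguments.
Unset Strict Implicit.
Unset Printing Implicit Defensive.

Local Open Scope classical_set_scope.
Local Open Scope ring_scope.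

(* The library's [completeType] requires a distinguished point of the carrier;
   completeness is stated here as a property, so that no point is part of the
   data. *)
Definition complete_metric (R : realType) (X : metricType R) : Prop :=
  forall u : nat -> X, cauchy (u @ \oo) -> exists l : X, u @ \oo --> l.

(* The library's [bounded_set] is only available for normed spaces. *)
Definition metric_bounded (R : realType) (X : metricType R) (A : set X) : Prop :=
  exists M : R, forall x y : X, A x -> A y -> mdist x y <= M.

(* Main.v *)
Require Import Defs.
From mathcomp Require Import all_boot all_order all_algebra.
From mathcomp Require Import all_classical all_reals all_analysis.
From mathcomp Require Import ring lra.

(** The common fixed point is the limit of the orbit [g^n x0], where [x0] has a
    bounded [f]-orbit.  Because [f] and [g] commute, the contraction hypothesis
    can be iterated on both sides at once ([commuting_contraction_iter]):
      [d (g^n u) (g^n v) <= k^n d (f^n u) (f^n v)].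
    With [u = x0] and [v = f x0] or [v = g x0], the right-hand distances stay
    bounded along the [f]-orbit of [x0]: for [v = f x0] by hypothesis, for
    [v = g x0] because [f^n (g x0) = g (f^n x0)] and [g] maps the bounded
    [f]-orbit to a bounded set ([orbit_displacement_bounded]).  Hence
    [d (g^n x0) (g (g^n x0))] and [d (g^n x0) (f (g^n x0))] are both at most a
    constant times [k^n].
    The first bound makes [g^n x0] converge to some [p]
    ([cvg_of_geometric_steps]); the two together show that the images of this
    sequence under [g] and [f] converge to [p] as well ([geometric_close_cvg]),
    and by continuity they converge to [g p] and [f p], the continuity of [g]
    being inherited from [f] ([relative_contraction_continuous]).  Two common
    fixed points [p] and [q] satisfy [d p q <= k d p q], so they coincide. *)

Set Implicit Arguments.
Unset Strict Implicit.

Import Order.TTheory GRing.Theory Num.Theory.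
Import metricType_numDomainType.

Local Open Scope classical_set_scope.
Local Open Scope ring_scope.

Lemma geometric_lt_near (R : realType) (C k e : R) :
  0 < k -> k < 1 -> 0 < e -> \forall n \near \oo, C * k ^+ n < e.
Proof.
move=> k0 k1 e0.
have k_norm : `|k| < 1 by rewrite gtr0_norm.
have geo0 := @cvg_geometric R C k k_norm.
exact: (@cvgr_lt R _ _ _ (geometric C k) 0 geo0 e e0).
Qed.

Lemma geometric_close_cvg (R : realType) (X : metricType R) (C k : R)
    (u v : nat -> X) (p : X) :
  0 < k -> k < 1 -> (forall n, mdist (u n) (v n) <= C * k ^+ n) ->
  u @ \oo --> p -> v @ \oo --> p.
Proof.
move=> k0 k1 uv up; apply/cvgrPdist_lt => e e0.
have e20 : 0 < e / 2 by rewrite divr_gt0.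
near=> n.
have pu : mdist p (u n) < e / 2 by near: n; exact: cvgr_dist_lt.
have geo : C * k ^+ n < e / 2 by near: n; exact: geometric_lt_near.
have := metric_triangle p (u n) (v n); have := uv n; lra.
Unshelve. all: by end_near.
Qed.

Lemma geometric_steps_dist (R : realType) (X : metricType R) (C k : R)
    (u : nat -> X) :
  0 < k -> k < 1 -> (forall n, mdist (u n) (u n.+1) <= C * k ^+ n) ->
  forall j n, mdist (u n) (u (n + j)%N) <= C / (1 - k) * k ^+ n.
Proof.
move=> k0 k1 step.
have C0 : 0 <= C.
  by have := step 0%N; rewrite expr0 mulr1; apply: le_trans; exact: mdist_ge0.
elim=> [|j IHj] n.
  rewrite addn0 mdistxx mulr_ge0 ?exprn_ge0 ?divr_ge0 ?subr_ge0 //; exact: ltW.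
apply: le_trans (metric_triangle _ (u n.+1) _) _.
rewrite addnS -addSn.
(* Sum of a geometric series: the first term plus [k] times the whole. *)
have -> : C / (1 - k) * k ^+ n = C * k ^+ n + C / (1 - k) * k ^+ n.+1.
  by rewrite exprS; field; rewrite subr_eq0 gt_eqF.
exact: lerD (step n) (IHj _).
Qed.

Lemma cvg_of_geometric_steps (R : realType) (X : metricType R) (C k : R)
    (u : nat -> X) :
  complete_metric X -> 0 < k -> k < 1 ->
  (forall n, mdist (u n) (u n.+1) <= C * k ^+ n) ->
  exists p : X, u @ \oo --> p.
Proof.
move=> cX k0 k1 step; apply: cX; apply: cauchy_exP => e e0.
have [N _ geo] := @geometric_lt_near R (C / (1 - k)) k e k0 k1 e0.
exists (u N); exists N => // n /= Nn.
rewrite ballEmdist /= -(subnKC Nn).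
apply: le_lt_trans (geometric_steps_dist k0 k1 step _ _) _.
by apply: geo => /=.
Qed.

Lemma iter_comm (T : Type) (f g : T -> T) :
  f \o g =1 g \o f -> forall n x, iter n f (g x) = g (iter n f x).
Proof. by move=> fg; elim=> //= n IHn x; rewrite IHn; exact: fg. Qed.

(** Each application of [g] trades for one application of [f] and a factor [k];
    commutation lets the new [f] move inside the remaining iterates of [g]. *)
Lemma commuting_contraction_iter (R : realType) (X : metricType R)
    (f g : X -> X) (k : R) :
  f \o g =1 g \o f -> 0 < k ->
  (forall x y, mdist (g x) (g y) <= k * mdist (f x) (f y)) ->
  forall n x y,
    mdist (iter n g x) (iter n g y) <= k ^+ n * mdist (iter n f x) (iter n f y).
Proof.
move=> fg k0 gf; elim=> [|n IHn] x y; first by rewrite expr0 mul1r.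
have gfC : g \o f =1 f \o g by move=> z; rewrite fg.
rewrite iterS [iter n.+1 g y]iterS; apply: le_trans (gf _ _) _.
rewrite -!(iter_comm gfC) exprS -mulrA ler_pM2l //.
by rewrite !iterSr; exact: IHn.
Qed.

Lemma relative_contraction_continuous (R : realType) (X : metricType R)
    (f g : X -> X) (k : R) :
  0 < k -> (forall x y, mdist (g x) (g y) <= k * mdist (f x) (f y)) ->
  continuous f -> continuous g.
Proof.
move=> k0 gf cf x; apply/cvgrPdist_lt => e e0.
have ek0 : 0 < e / k by rewrite divr_gt0.
near=> y; apply: le_lt_trans (gf _ _) _; rewrite mulrC -ltr_pdivlMr //.
by near: y; exact: cvgr_dist_lt (cf x) _ ek0.
Unshelve. all: by end_near.
Qed.

(** Along a bounded [f]-orbit the displacement of [g] is bounded: compare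
    [f^n x] with [g (f^n x)] through [x] and [g x]. *)
Lemma orbit_displacement_bounded (R : realType) (X : metricType R)
    (f g : X -> X) (k M : R) (x : X) :
  0 < k -> (forall y z, mdist (g y) (g z) <= k * mdist (f y) (f z)) ->
  (forall m n, mdist (iter m f x) (iter n f x) <= M) ->
  forall n, mdist (iter n f x) (g (iter n f x)) <= M + mdist x (g x) + k * M.
Proof.
move=> k0 gf bM n.
have t1 := metric_triangle (iter n f x) x (g (iter n f x)).
have t2 := metric_triangle x (g x) (g (iter n f x)).
have b1 := bM n 0%N.
have b2 : mdist (g x) (g (iter n f x)) <= k * M.
  by apply: le_trans (gf _ _) _; rewrite ler_pM2l //; exact: (bM 1%N n.+1).
rewrite /= in b1; lra.
Qed.

Unset Implicit Arguments.
Set Strict Implicit.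

Theorem theorem3p1 (R : realType) (X : metricType R) (hX : complete_metric X)
    (f g : X -> X) (hfg : f \o g =1 g \o f) (hf : continuous f)
    (k : R) (hk0 : 0 < k) (hk1 : k < 1)
    (hgf : forall x y : X, mdist (g x) (g y) <= k * mdist (f x) (f y))
    (hbdd : exists x0 : X, metric_bounded (range (fun n : nat => iter n f x0))) :
  exists! p : X, f p = p /\ g p = p.
Proof.
case: hbdd => x [M orbM].
have bM m n : mdist (iter m f x) (iter n f x) <= M.
  by apply: orbM; [exists m | exists n].
have contr := commuting_contraction_iter hfg hk0 hgf.
have gfC : g \o f =1 f \o g by move=> z; rewrite hfg.
pose u n := iter n g x.
have kn0 n : 0 < k ^+ n by exact: exprn_gt0.
have gu n : mdist (u n) (g (u n)) <= (M + mdist x (g x) + k * M) * k ^+ n.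
  rewrite /u -iterS iterSr mulrC; apply: le_trans (contr _ _ _) _.
  rewrite ler_pM2l // (iter_comm hfg).
  exact: orbit_displacement_bounded hk0 hgf bM n.
have fu n : mdist (u n) (f (u n)) <= M * k ^+ n.
  rewrite /u -(iter_comm gfC) mulrC; apply: le_trans (contr _ _ _) _.
  by rewrite ler_pM2l // -iterSr.
have [p up] := cvg_of_geometric_steps hX hk0 hk1 gu.
have fixed_limit (h : X -> X) (C : R) : continuous h ->
    (forall n, mdist (u n) (h (u n)) <= C * k ^+ n) -> h p = p.
  move=> ch hu.
  have hu_hp : h (u n) @[n --> \oo] --> h p by exact: continuous_cvg (ch p) up.
  have hu_p : h (u n) @[n --> \oo] --> p.
    exact: geometric_close_cvg hk0 hk1 hu up.
  exact: (cvg_unique (@metric_hausdorff R X) hu_hp hu_p).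
have fp : f p = p := fixed_limit f M hf fu.
have gp : g p = p :=
  fixed_limit g _ (relative_contraction_continuous hk0 hgf hf) gu.
exists p; split=> // q [fq gq].
have := hgf p q; rewrite gp gq fp fq => dpq.
apply: mdist_positivity; apply/eqP; rewrite eq_le mdist_ge0 andbT.
nra.
Qed.
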